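(* Fix a polynomial $R\in\mathbb C[X]$. Let $G^c=R(t\partial_t)\partial_t$ acting on $\mathbb C[t]$ and $G^d=R(-x\nabla)\Delta$ acting on $\mathbb C[x]$, and for $n=0,1,2,\dots$ put $$P_n^c(t)=e^{G^c}t^n=\sum_{j\ge0}\frac{(G^c)^jt^n}{j!},\qquad P_n^d(x)=e^{G^d}(x)_n=\sum_{j\ge0}\frac{(G^d)^j(x)_n}{j!}.$$ Then the Mellin type transform $\mathcal M^*$ maps the continuous system $\{P_n^c\}$ into the discrete system $\{P_n^d\}$ with the same $R$; moreover, for all $n$, $$\mathcal M^*(P_n^c(t))=P_n^d(x).$$
   Context: $\Delta f(x)=f(x+1)-f(x)$, $\nabla f(x)=f(x-1)-f(x)$, and $(x)_n=x(x-1)\cdots(x-n+1)$, $(x)_0=1$, is the falling factorial. Both series are finite because $G^c$ and $G^d$ lower degrees. The Mellin type transform $\mathcal M^*:\mathbb C[t]\to\mathbb C[x]$ is $$\mathcal M^*(f)(x)=\frac1{\Gamma(-x)}\int_0^\infty f(-t)\,t^{-x-1}e^{-t}\,dt$$ (for $\operatorname{Re}x<0$, the result being a polynomial in $x$); equivalently, it is the linear isomorphism $\mathbb C[t]\to\mathbb C[x]$ determined by $\mathcal M^*(t^n)=(x)_n$ for all $n\ge0$. *)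

(* Defs.v *)
From mathcomp Require Export all_boot all_order all_algebra.
From mathcomp Require Export all_classical all_reals all_analysis.
From mathcomp Require Export complex.

Set Implicit Arguments.
Unset Strict Implicit.
Unset Printing Implicit Defensive.

Export Order.TTheory GRing.Theory Num.Theory.
Export numFieldNormedType.Exports.

Global Open Scope classical_set_scope.
Global Open Scope ring_scope.
Global Open Scope complex_scope.

Section Operators.
Context {F : fieldType}.
Implicit Types (r f : {poly F}) (A G : {poly F} -> {poly F}).

Definition poly_op r A f : {poly F} := \sum_(i < size r) r`_i *: iter i A f.

(* The sum ranges over all natural numbers: it is the finitely supported sum of
   fsbigop, meaningful here because it is only applied to operators lowering
   the degree. *)
Definition exp_op G f : {poly F} :=
  \sum_(j \in [set: nat]) (j`!%:R)^-1 *: iter j G f.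

Definition falling n : {poly F} := \prod_(i < n) ('X - i%:R%:P).

Definition fwd_diff f : {poly F} := f \Po ('X + 1) - f.

(* The sign is that of [f(x - 1) - f(x)], opposite to the usual convention. *)
Definition bwd_diff f : {poly F} := f \Po ('X - 1) - f.

Definition Gc r f : {poly F} := poly_op r (fun g => 'X * g^`()) f^`().
Definition Gd r f : {poly F} :=
  poly_op r (fun g => - 'X * bwd_diff g) (fwd_diff f).

Definition Pc r n : {poly F} := exp_op (Gc r) 'X^n.
Definition Pd r n : {poly F} := exp_op (Gd r) (falling n).

End Operators.

Section MellinTransform.
Context {K : realType}.
Local Notation C := K[i].

Definition Cexp (z : C) : C :=
  (expR (complex.Re z) * cos (complex.Im z))
    +i* (expR (complex.Re z) * sin (complex.Im z)).

(* [t ^ s] for [t > 0]. *)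
Definition Cpow (t : K) (s : C) : C := Cexp (s * (ln t)%:C).

Definition Cintegral (D : set K) (h : K -> C) : C :=
  (\int[lebesgue_measure]_(t in D) complex.Re (h t))
    +i* (\int[lebesgue_measure]_(t in D) complex.Im (h t)).

(* Euler's integral, used for [Re s > 0] only. *)
Definition Gamma (s : C) : C :=
  Cintegral `]0, +oo[ (fun t => Cpow t (s - 1) * (expR (- t))%:C).

Definition mellin_value (f : {poly C}) (x : C) : C :=
  (Gamma (- x))^-1 *
  Cintegral `]0, +oo[
    (fun t => f.[- t%:C] * Cpow t (- x - 1) * (expR (- t))%:C).

(* The transform of [f] is the polynomial, unique when it exists, whose values
   on [Re x < 0] are given by the integral; 0 is a default value. *)
Definition Mellin (f : {poly C}) : {poly C} :=
  xget 0 [set g : {poly C} |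
    forall x : C, complex.Re x < 0 -> g.[x] = mellin_value f x].

End MellinTransform.

(* Main.v *)
(** The falling factorials satisfy Delta (x)_n = n (x)_(n-1) and
    (- x nabla) (x)_n = n (x)_n, so the linear map [falling_map] sending t^n to
    (x)_n intertwines d/dt with Delta and t d/dt with - x nabla, hence Gc with
    Gd and the (terminating) exponentials.  It remains to see that the integral
    transform is this map.  On t^n the integral is (-1)^n Gamma(n - x), which
    the functional equation turns into (x)_n Gamma(- x), and one has to divide
    by Gamma(- x): Gamma must not vanish on the right half-plane.  By the
    functional equation it is enough to prove Gamma(a + i tau) <> 0 for large a,
    where the mass of t^(a-1) e^(-t) concentrates around t = a:
    Re (a^(- i tau) Gamma(a + i tau)) is the integral of
    t^(a-1) e^(-t) cos(tau ln(t/a)), and cos y >= 1 - y^2/2 together with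
    (ln u)^2 <= 4 (u - 2 + 1/u) bounds it below by
    Gamma(a) (1 - 2 tau^2 / (a - 1)). *)

Require Import Defs.
From HB Require Import structures.
From mathcomp Require Import zify ring lra measurable_realfun.

Set Implicit Arguments.
Unset Strict Implicit.
Unset Printing Implicit Defensive.

(** * The falling factorial map *)

Section FallingMap.
Context {F : fieldType}.
Implicit Types (r f g : {poly F}).

Definition falling_map f : {poly F} := \sum_(i < size f) f`_i *: falling i.

Lemma falling_map_widen n f : (size f <= n)%N ->
  falling_map f = \sum_(i < n) f`_i *: falling i.
Proof.
move=> fn; rewrite /falling_map (big_ord_widen n (fun i => f`_i *: falling i))//.
rewrite big_mkcond/=; apply: eq_bigr => i _.
by case: ltnP => // /(nth_default 0) ->; rewrite scale0r.
Qed.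

Lemma falling_map_is_linear : linear falling_map.
Proof.
move=> a f g; pose n := maxn (size f) (size g).
have fn : (size f <= n)%N by rewrite leq_maxl.
have gn : (size g <= n)%N by rewrite leq_maxr.
have afgn : (size (a *: f + g)%R <= n)%N.
  rewrite (leq_trans (size_polyD _ _))// geq_max gn andbT.
  exact: leq_trans (size_scale_leq _ _) fn.
rewrite !(falling_map_widen (n := n))// scaler_sumr -big_split/=.
by apply: eq_bigr => i _; rewrite coefD coefZ scalerDl scalerA.
Qed.

HB.instance Definition _ :=
  GRing.isLinear.Build F {poly F} {poly F} _ falling_map falling_map_is_linear.

Lemma falling_mapXn n : falling_map 'X^n = falling n.
Proof.
rewrite (falling_map_widen (n := n.+1)) ?size_polyXn// big_ord_recr/=.
rewrite coefXn eqxx scale1r big1 ?add0r// => i _.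
by rewrite coefXn (ltn_eqF (ltn_ord i)) scale0r.
Qed.

(** Named forms, convertible to the operators inside [Gc] and [Gd], so that these can carry a linear
    structure. *)
Definition euler f : {poly F} := 'X * f^`().
Definition bwd_euler f : {poly F} := - 'X * bwd_diff f.

Lemma euler_is_linear : linear euler.
Proof.
by move=> a f g; rewrite /euler derivD derivZ mulrDr scalerAr.
Qed.

Lemma fwd_diff_is_linear : linear (@fwd_diff F).
Proof.
move=> a f g; rewrite /fwd_diff comp_polyD comp_polyZ scalerBr.
by rewrite opprD addrACA.
Qed.

Lemma bwd_euler_is_linear : linear bwd_euler.
Proof.
move=> a f g; rewrite /bwd_euler /bwd_diff comp_polyD comp_polyZ scalerAr.
by rewrite -mulrDr scalerBr opprD addrACA.
Qed.

HB.instance Definition _ :=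
  GRing.isLinear.Build F {poly F} {poly F} _ euler euler_is_linear.
HB.instance Definition _ :=
  GRing.isLinear.Build F {poly F} {poly F} _ (@fwd_diff F) fwd_diff_is_linear.
HB.instance Definition _ :=
  GRing.isLinear.Build F {poly F} {poly F} _ bwd_euler bwd_euler_is_linear.

(** Monomials span, so each intertwining relation below is checked on powers of ['X] only. *)
Lemma linear_poly_ext (A B : {linear {poly F} -> {poly F}}) :
  (forall n, A 'X^n = B 'X^n) -> A =1 B.
Proof.
move=> AB f; rewrite -[f]coefK poly_def !linear_sum.
by apply: eq_bigr => i _; rewrite !linearZ AB.
Qed.

Lemma fallingS n : falling n.+1 = falling n * ('X - n%:R%:P) :> {poly F}.
Proof. by rewrite /falling big_ord_recr. Qed.

(** The shift turns the factor x - k into x - (k - 1): the first factor becomes x + 1 and the others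
    recombine into (x)_n. *)
Lemma falling_succ_shift n :
  falling n.+1 \Po ('X + 1) = ('X + 1) * falling n :> {poly F}.
Proof.
elim: n => [|n IH].
  by rewrite /falling big_ord_recl !big_ord0 !mulr1 subr0 comp_polyX.
rewrite fallingS comp_polyM IH fallingS -mulrA; congr (_ * (_ * _)).
by rewrite comp_polyB comp_polyX comp_polyC mulrS polyCD addrKA.
Qed.

Lemma falling_succ_pred n :
  falling n.+1 = 'X * (falling n \Po ('X - 1)) :> {poly F}.
Proof.
have := congr1 (comp_poly ('X - 1)) (falling_succ_shift n).
rewrite -comp_polyA !(comp_polyM, comp_polyD) comp_polyX.
have -> : 1 \Po ('X - 1) = 1 :> {poly F} by rewrite -polyC1 comp_polyC.
by rewrite subrK comp_polyXr.
Qed.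

(** Both (x+1)_(n+1) and (x)_(n+1) contain (x)_n; the cofactors x + 1 and x - n differ by n + 1. *)
Lemma fwd_diff_falling n :
  fwd_diff (falling n.+1) = n.+1%:R *: falling n :> {poly F}.
Proof.
rewrite /fwd_diff falling_succ_shift fallingS [(_ + 1) * _]mulrC -mulrBr.
rewrite opprB addrCA addrAC subrr add0r -polyC1 -polyCD -natr1 mulrC.
exact: mul_polyC.
Qed.

(** Since x (x-1)_n = (x)_(n+1) = (x)_n (x - n), the operator multiplies (x)_n by x - (x - n) =
    n. *)
Lemma bwd_euler_falling n :
  bwd_euler (falling n) = n%:R *: falling n :> {poly F}.
Proof.
rewrite /bwd_euler /bwd_diff mulrBr mulNr -falling_succ_pred fallingS.
by rewrite mulNr opprK mulrBr [_ * 'X]mulrC opprB addrNK mulrC mul_polyC.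
Qed.

Lemma falling_map_deriv f : falling_map f^`() = fwd_diff (falling_map f).
Proof.
apply: (linear_poly_ext (A := falling_map \o deriv)
                        (B := @fwd_diff F \o falling_map)) => -[|n] /=.
  rewrite falling_mapXn expr0 -polyC1 derivC linear0 /fwd_diff /falling big_ord0.
  by rewrite -polyC1 comp_polyC subrr.
by rewrite falling_mapXn derivXn/= fwd_diff_falling -scaler_nat linearZ/=
  falling_mapXn.
Qed.

Lemma falling_map_euler f : falling_map (euler f) = bwd_euler (falling_map f).
Proof.
apply: (linear_poly_ext (A := falling_map \o euler)
                        (B := bwd_euler \o falling_map)) => n /=.
rewrite falling_mapXn bwd_euler_falling /euler derivXn.
case: n => [|n]; first by rewrite mulr0n mulr0 linear0 scale0r.
by rewrite mulrnAr -exprS -scaler_nat linearZ/= falling_mapXn.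
Qed.

Lemma falling_map_Gc r f : falling_map (Gc r f) = Gd r (falling_map f).
Proof.
rewrite /Gc /Gd /poly_op linear_sum; apply: eq_bigr => i _.
rewrite linearZ/= -falling_map_deriv; congr (_ *: _).
elim: (i : nat) => //= k IH.
by rewrite -[RHS]/(bwd_euler _) -IH -falling_map_euler.
Qed.

(** * Degree lowering and the terminating exponentials *)

Lemma size_poly_op_euler r f : (size (poly_op r euler f) <= size f)%N.
Proof.
apply: (leq_trans (size_sum _ _ _)); apply/bigmax_leqP => i _.
apply: (leq_trans (size_scale_leq _ _)).
elim: (i : nat) => //= k; apply: leq_trans.
set g := iter k _ _; have [->|g0] := eqVneq g 0.
  by rewrite linear0 size_poly0.
rewrite (leq_trans (size_polyMleq _ _))// size_polyX.
by have := lt_size_deriv g0.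
Qed.

Lemma size_Gc r f : (size (Gc r f) <= (size f).-1)%N.
Proof. by rewrite (leq_trans (size_poly_op_euler _ _))// size_poly. Qed.

Lemma iter_Gc_eq0 r f : iter (size f) (Gc r) f = 0.
Proof.
apply/eqP; rewrite -size_poly_eq0 -leqn0.
suff: forall k, (size (iter k (Gc r) f) <= size f - k)%N.
  by move/(_ (size f)); rewrite subnn.
elim=> [|k IH]; first by rewrite subn0.
by rewrite iterS (leq_trans (size_Gc _ _))// subnS; lia.
Qed.

(** The condition [G 0 = 0] keeps every iterate from the m-th on at zero, so the support of the sum
    lies below m. *)
Lemma exp_op_finite (G : {poly F} -> {poly F}) f m :
  G 0 = 0 -> iter m G f = 0 ->
  exp_op G f = \sum_(j < m) (j`!%:R)^-1 *: iter j G f.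
Proof.
move=> G0 Gm.
rewrite (fsbig_ord +%R m (fun j => (j`!%:R)^-1 *: iter j G f)).
apply/esym/fsbig_widen => // j [_ /negP].
rewrite -leqNgt => mj /=.
rewrite -(subnK mj) iterD Gm.
by rewrite [iter _ _ 0](_ : _ = 0) ?scaler0//; elim: (j - m)%N => //= k ->.
Qed.

Lemma falling_map_Pc r n : falling_map (Pc r n) = Pd r n.
Proof.
have iterT j : falling_map (iter j (Gc r) 'X^n) = iter j (Gd r) (falling n).
  by elim: j => [|j IH]; rewrite ?falling_mapXn// !iterS falling_map_Gc IH.
have Gc0 : Gc r 0 = 0 :> {poly F}.
  apply/eqP; rewrite -size_poly_eq0 -leqn0.
  by rewrite (leq_trans (size_Gc _ _))// size_poly0.
have Gd0 : Gd r 0 = 0 :> {poly F}.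
  by rewrite -(linear0 falling_map) -falling_map_Gc Gc0.
have Gcn := iter_Gc_eq0 r 'X^n.
(* Termination on the discrete side is transported through [falling_map] instead of being read off
   from degrees. *)
have Gdn : iter (size ('X^n : {poly F})) (Gd r) (falling n) = 0.
  by rewrite -iterT Gcn linear0.
rewrite /Pc /Pd (exp_op_finite Gc0 Gcn) (exp_op_finite Gd0 Gdn) linear_sum.
by apply: eq_bigr => j _; rewrite linearZ/= iterT.
Qed.

End FallingMap.

(** * Integration over the positive half-line *)

Section HalfLine.
Context {R : realType}.
Local Notation mu := (@lebesgue_measure R).
Local Notation U := (`]0%R, +oo[%classic : set R).
Implicit Types (f F : R -> R).

Lemma half_line_gt0 (t : R) : U t -> 0 < t.
Proof. by rewrite /= in_itv/= andbT. Qed.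

(** The endpoints are offset so that even the first segment, [1, 2], is nondegenerate, and every
    segment stays away from 0. *)
Definition half_line_segment (n : nat) : set R :=
  `[n.+1%:R^-1, n.+2%:R]%classic.

Lemma half_line_segment_nondecreasing : nondecreasing_seq half_line_segment.
Proof.
move=> m n mn; apply/subsetPset => t.
rewrite /half_line_segment/= !in_itv/= => /andP[mt tm].
apply/andP; split.
  by apply: le_trans mt; rewrite lef_pV2 ?posrE// ler_nat.
by apply: (le_trans tm); rewrite ler_nat.
Qed.

Lemma bigcup_half_line_segment : \bigcup_n half_line_segment n = U.
Proof.
apply/seteqP; split => t.
  move=> [n _]; rewrite /half_line_segment/= !in_itv/= andbT => /andP[+ _].
  exact: lt_le_trans.
rewrite /= in_itv/= andbT => t0.
(* Adding the two truncations makes n + 1 exceed 1/t and n + 2 exceed t at once. *)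
pose n := (Num.trunc t^-1 + Num.trunc t)%N; exists n => //.
rewrite /half_line_segment/= in_itv/=.
apply/andP; split.
  rewrite invf_ple ?posrE// (le_trans (ltW (truncnS_gt _)))// ler_nat.
  by rewrite ltnS leq_addr.
rewrite (le_trans (ltW (truncnS_gt _)))// ler_nat (@leq_trans n.+1)//.
by rewrite ltnS leq_addl.
Qed.

Lemma half_line_segment_sub n : half_line_segment n `<=` U.
Proof. by rewrite -bigcup_half_line_segment; exact: bigcup_sup. Qed.

Lemma half_line_segment_lt n : n.+1%:R^-1 < n.+2%:R :> R.
Proof.
by rewrite (le_lt_trans (y := 1))// ?invf_le1// ?ler1n// ltr1n.
Qed.

Lemma continuous_half_line_measurable f :
  (forall t : R, 0 < t -> {for t, continuous f}) -> measurable_fun U f.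
Proof.
move=> cf; apply: open_continuous_measurable_fun => // t.
by rewrite inE/= in_itv/= andbT => /cf.
Qed.

Lemma integral_half_line_segment F f n :
  (forall t : R, 0 < t -> {for t, continuous f}) ->
  (forall t : R, 0 < t -> is_derive t 1 F (f t)) ->
  (\int[mu]_(t in half_line_segment n) (f t)%:E =
   (F n.+2%:R - F n.+1%:R^-1)%:E)%E.
Proof.
move=> cf dF.
have gt0 (t : R) : t \in `[n.+1%:R^-1, n.+2%:R] -> 0 < t.
  by rewrite in_itv/= => /andP[+ _]; exact: lt_le_trans.
have cF (t : R) : 0 < t -> {for t, continuous F}.
  move=> t0; apply: differentiable_continuous; apply/derivable1_diffP.
  by have [] := dF _ t0.
have n1 : 0 < n.+1%:R^-1 :> R by rewrite invr_gt0.
rewrite (@continuous_FTC2 _ f F) ?half_line_segment_lt//.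
- apply: continuous_in_subspaceT => t; rewrite inE/= => /gt0; exact: cf.
- split.
  + by move=> t /subset_itv_oo_cc/gt0/dF[].
  + by apply/cvg_at_right_filter; exact: cF.
  + by apply/cvg_at_left_filter; exact: cF.
- by move=> t /subset_itv_oo_cc/gt0/dF; rewrite derive1E => H; rewrite derive_val.
Qed.

(** By monotone convergence along the segments: each partial integral is an increment of [F], hence
    at most 2M. *)
Lemma integrable_bounded_antiderivative F f (M : R) :
  (forall t : R, 0 < t -> {for t, continuous f}) ->
  (forall t : R, 0 < t -> is_derive t 1 F (f t)) ->
  (forall t : R, 0 < t -> 0 <= f t) ->
  (forall t : R, 0 < t -> `|F t| <= M) ->
  mu.-integrable U (EFin \o f).
Proof.
move=> cf dF f0 FM.
have mf := continuous_half_line_measurable cf.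
apply/integrableP; split; first exact/measurable_EFinP.
under eq_integral.
  move=> t; rewrite inE => /half_line_gt0 t0 /=; rewrite ger0_norm ?f0//.
  over.
rewrite /=.
have cvD : (\int[mu]_(t in half_line_segment n) (f t)%:E @[n --> \oo] -->
            \int[mu]_(t in U) (f t)%:E)%E.
  rewrite -bigcup_half_line_segment; apply: ge0_nondecreasing_set_cvg_integral.
  - exact: half_line_segment_nondecreasing.
  - by move=> i; exact: measurable_itv.
  - move=> i; apply/measurable_EFinP; apply: measurable_funS mf => //.
    exact: half_line_segment_sub.
  - by move=> i t /half_line_segment_sub/half_line_gt0 t0; rewrite lee_fin f0.
rewrite -(cvg_lim _ cvD)//.
apply: (@le_lt_trans _ _ (M + M)%:E); last exact: ltry.
apply: lime_le; first by apply/cvg_ex; eexists; exact: cvD.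
apply: nearW => n; rewrite (integral_half_line_segment _ cf dF) lee_fin.
have n1 : 0 < n.+1%:R^-1 :> R by rewrite invr_gt0.
have /ler_normlP[_ h1] := FM _ (ltr0Sn R n.+1).
by have /ler_normlP[h2 _] := FM _ n1; lra.
Qed.

(** The fundamental theorem on each segment passes to the limit by dominated convergence: [f] cut
    off to the segments converges pointwise to [f] and is dominated by |f|. *)
Lemma Rintegral_half_line F f (l0 l1 : R) :
  (forall t : R, 0 < t -> {for t, continuous f}) ->
  (forall t : R, 0 < t -> is_derive t 1 F (f t)) ->
  mu.-integrable U (EFin \o f) ->
  F t @[t --> 0^'+] --> l0 -> F t @[t --> +oo] --> l1 ->
  \int[mu]_(t in U) f t = l1 - l0.
Proof.
move=> cf dF fi F0 F1.
have mf := continuous_half_line_measurable cf.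
pose g n := (EFin \o f) \_ (half_line_segment n).
have cvD : (\int[mu]_(t in U) g n t @[n --> \oo] -->
            \int[mu]_(t in U) (f t)%:E)%E.
  suff [_ _ +] : [/\ mu.-integrable U (EFin \o f),
      [sequence \int[mu]_(t in U) `|g n t - (f t)%:E|]_n @ \oo --> 0 &
      [sequence \int[mu]_(t in U) g n t]_n @ \oo -->
        \int[mu]_(t in U) (f t)%:E]%E.
    by [].
  apply: (@dominated_convergence _ _ _ mu U _ g _ (fun t => `|f t|%:E)) => //.
  - move=> n; apply/(measurable_restrict _ _ _) => //; first exact: measurable_itv.
    apply/measurable_EFinP; apply: measurable_funS mf => //.
  - exact/measurable_EFinP.
  - apply: aeW => t Ut; rewrite -bigcup_half_line_segment in Ut; case: Ut => N _ DN.
    apply: cvg_near_cst; near=> n; rewrite /g patchE mem_set//.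
    suff : half_line_segment N `<=` half_line_segment n by exact.
    apply/subsetPset; apply: half_line_segment_nondecreasing; near: n.
    by exists N.
  - exact: integrable_norm.
  - apply: aeW => t n Ut; rewrite /g patchE; case: ifP => _ //=.
    by rewrite ?abse0 ?normr0 lee_fin.
have gE n : (\int[mu]_(t in U) g n t = (F n.+2%:R - F n.+1%:R^-1)%:E)%E.
  rewrite -(integral_half_line_segment _ cf dF) -integral_mkcondr setIidr//.
  exact: half_line_segment_sub.
have cvF : (F n.+2%:R - F n.+1%:R^-1) @[n --> \oo] --> l1 - l0.
  apply: cvgB.
    move/cvg_pinftyP : F1; apply.
    apply/cvgryPge => A; near=> n.
    rewrite (@le_trans _ _ n%:R)// ?ler_nat//; last by lia.
    by near: n; apply: nbhs_infty_ger.
  move/cvg_at_rightP : F0; apply; split; first by move=> n; rewrite invr_gt0.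
  exact: cvg_harmonic.
have cvD' : (\int[mu]_(t in U) g n t @[n --> \oo] --> (l1 - l0)%:E)%E.
  under eq_cvg do rewrite gE.
  by apply: cvg_EFin => //; exact: nearW.
have eqI : (\int[mu]_(t in U) (f t)%:E = (l1 - l0)%:E)%E.
  by rewrite -(cvg_lim _ cvD)// (cvg_lim _ cvD').
by rewrite /Rintegral eqI.
Unshelve. all: by end_near. Qed.

Lemma integrable_half_lineD f g :
  mu.-integrable U (EFin \o f) -> mu.-integrable U (EFin \o g) ->
  mu.-integrable U (EFin \o (fun t => f t + g t)).
Proof. by move=> fi gi; exact: integrableD fi gi. Qed.

Lemma integrable_half_lineB f g :
  mu.-integrable U (EFin \o f) -> mu.-integrable U (EFin \o g) ->
  mu.-integrable U (EFin \o (fun t => f t - g t)).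
Proof. by move=> fi gi; exact: integrableB fi gi. Qed.

Lemma integrable_half_lineZl (k : R) f : mu.-integrable U (EFin \o f) ->
  mu.-integrable U (EFin \o (fun t => k * f t)).
Proof. by move=> fi; exact: integrableZl fi. Qed.

End HalfLine.

(** * Integrals of t^(s-1) e^(-t) cos(tau ln t + phi) *)

Section Kernel.
Context {R : realType}.
Local Notation mu := (@lebesgue_measure R).
Local Notation U := (`]0%R, +oo[%classic : set R).
Implicit Types (s tau phi t : R).

Lemma ler_sqr_norm (x y : R) : `|x| <= `|y| -> x ^+ 2 <= y ^+ 2.
Proof.
move=> xy; rewrite -(real_normK (num_real x)) -(real_normK (num_real y)).
by rewrite lerXn2r ?nnegrE.
Qed.

(** For x > 0 the mean value theorem gives sin x = x cos c; oddness covers x < 0. *)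
Lemma ler_norm_sin (x : R) : `|sin x| <= `|x|.
Proof.
wlog x0 : x / 0 <= x.
  move=> H; have [|/ltW] := leP 0 x; first exact: H.
  by rewrite -oppr_ge0 => /H; rewrite sinN !normrN.
have [->|xn0] := eqVneq x 0; first by rewrite sin0.
have {xn0 x0}x0 : 0 < x by rewrite lt_neqAle eq_sym xn0.
have [c _] := @MVT R sin cos 0 x x0 (fun y _ => is_derive_sin y)
  (continuous_subspaceT (@continuous_sin R)).
rewrite sin0 !subr0 => ->; rewrite normrM ler_piMl//; exact: cos_max.
Qed.

(** Half-angle formula: cos x = 1 - 2 sin^2 (x/2). *)
Lemma cos_ge1B (x : R) : 1 - x ^+ 2 / 2 <= cos x.
Proof.
rewrite [in leRHS](_ : x = (x / 2) *+ 2); last by rewrite -mulr_natr divfK.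
rewrite cos_mulr2n.
have h := cos2Dsin2 (x / 2).
have : sin (x / 2) ^+ 2 <= (x / 2) ^+ 2 by exact/ler_sqr_norm/ler_norm_sin.
rewrite expr_div_n => h2; lra.
Qed.

(** With z = y/2 the right side is the square of 2 (e^z - e^(-z)), so the claim is |z| <= |e^z -
    e^(-z)|: the larger exponential is at least 1 + |z|, the smaller at most 1. For y = ln u this
    bounds (ln u)^2 by 4 (u - 2 + 1/u). *)
Lemma sqr_le_cosh (y : R) : y ^+ 2 <= 4 * (expR y - 2 + expR (- y)).
Proof.
have [z yE] : exists z, y = z + z by exists (y / 2); exact: splitr.
have h1 := expR_ge1Dx z; have h2 := expR_ge1Dx (- z).
rewrite yE [- (z + z)]opprD !expRD.
have pq : expR z * expR (- z) = 1 by rewrite expRN divff// gt_eqF// expR_gt0.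
have p0 := expR_gt0 z; have q0 := expR_gt0 (- z).
move: (expR z) (expR (- z)) h1 h2 pq p0 q0 => p q h1 h2 pq p0 q0.
have -> : 4 * (p * p - 2 + q * q) = (2 * (p - q)) ^+ 2.
  have -> : (2 * (p - q)) ^+ 2 = 4 * (p * p - 2 * (p * q) + q * q) by ring.
  by rewrite pq mulr1.
have -> : (z + z) ^+ 2 = (2 * z) ^+ 2 by ring.
apply: ler_sqr_norm; rewrite !normrM ler_pM2l ?normr_gt0//.
have [z0|z0] := leP 0 z.
  have q1 : q <= 1 by nra.
  by rewrite ger0_norm// (le_trans _ (ler_norm _))//; lra.
have p1 : p <= 1 by nra.
by rewrite ltr0_norm// distrC (le_trans _ (ler_norm _))//; lra.
Qed.

(* The phase [phi] makes real and imaginary parts, as well as rotations of the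
   Gamma integrand, instances of a single real kernel. *)
Definition kern s tau phi t :=
  expR ((s - 1) * ln t - t) * cos (tau * ln t + phi).

Lemma is_derive_kern s tau phi t : 0 < t ->
  is_derive t 1 (kern s tau phi)
    (expR ((s - 1) * ln t - t) *
     (((s - 1) / t - 1) * cos (tau * ln t + phi)
      - tau / t * sin (tau * ln t + phi))).
Proof.
move=> t0; have dln := is_derive1_ln t0.
have d1 : is_derive t 1 (fun t => (s - 1) * ln t - t) ((s - 1) / t - 1).
  by apply: is_derive_eq; rewrite ?addr0.
have d2 : is_derive t 1 (fun t => tau * ln t + phi) (tau / t).
  by apply: is_derive_eq; rewrite ?addr0.
have e1 := is_derive1_comp (is_derive_expR _) d1.
have e2 := is_derive1_comp (is_derive_cos _) d2.
apply: (is_derive_eq (is_deriveM e1 e2)).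
rewrite /GRing.scale/=; ring.
Qed.

Lemma expR_ln_shift s t : 0 < t ->
  expR (s * ln t - t) = t * expR ((s - 1) * ln t - t).
Proof.
move=> t0; rewrite -[X in _ = X * _]lnK ?posrE// -expRD; congr expR.
by ring.
Qed.

Lemma kernS s tau phi t : 0 < t -> kern (s + 1) tau phi t = t * kern s tau phi t.
Proof. by move=> t0; rewrite /kern addrK expR_ln_shift// mulrA. Qed.

(** Since - sin y = cos (y + pi/2), the derivative stays in the kernel family; this is the
    functional equation of Gamma before integration. *)
Lemma is_derive_kernS s tau phi t : 0 < t ->
  is_derive t 1 (kern (s + 1) tau phi)
    (s * kern s tau phi t - kern (s + 1) tau phi t
     + tau * kern s tau (phi + pi / 2) t).
Proof.
move=> t0; apply: (is_derive_eq (is_derive_kern (s + 1) tau phi t0)).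
rewrite /kern addrK (expR_ln_shift s)// [_ + (phi + _)]addrA cosDpihalf.
by field; rewrite gt_eqF.
Qed.

Lemma continuous_kern s tau phi t : 0 < t -> {for t, continuous (kern s tau phi)}.
Proof.
move=> t0; apply: differentiable_continuous; apply/derivable1_diffP.
by have [] := is_derive_kern s tau phi t0.
Qed.

Lemma normr_kern s tau phi t : `|kern s tau phi t| <= expR ((s - 1) * ln t - t).
Proof.
rewrite normrM ger0_norm ?expR_ge0// ler_piMr ?expR_ge0//; exact: cos_max.
Qed.

(* [ln t <= t / c + ln c] with [c = 2 s]. *)
Lemma expR_ln_bound s : 0 < s ->
  {C : R | 0 <= C & forall t, 0 < t -> expR (s * ln t) <= C * expR (t / 2)}.
Proof.
move=> s0; exists (expR (s * ln (2 * s))); first exact: expR_ge0.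
move=> t t0; rewrite -expRD ler_expR.
have s20 : 0 < 2 * s by rewrite mulr_gt0.
have -> : t / 2 = s * (t / (2 * s)) by field; rewrite gt_eqF.
rewrite -mulrDr ler_pM2l//.
rewrite -lerBlDl -ln_div ?posrE//; apply/ltW/ln_sublinear.
by rewrite divr_gt0.
Qed.

Lemma integrable_kern s tau phi : 0 < s ->
  mu.-integrable U (EFin \o kern s tau phi).
Proof.
(* The majorant is a multiple of [h], the derivative of [p / (1 + p)] for
   [p = t^s], which is bounded on the half-line. *)
move=> s0; have [C C0 CP] := expR_ln_bound s0.
pose p t := expR (s * ln t).
pose h t := s * p t / t / (1 + p t) ^+ 2.
have p0 t : 0 < p t by exact: expR_gt0.
have p1 t : 0 < 1 + p t by rewrite addr_gt0.
have dp t : 0 < t -> is_derive t 1 p (s * p t / t).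
  move=> t0; have dln := is_derive1_ln t0.
  have d1 : is_derive t 1 (fun t => s * ln t) (s / t).
    by apply: is_derive_eq; rewrite ?addr0.
  apply: (is_derive_eq (is_derive1_comp (is_derive_expR _) d1)).
  by rewrite /p; ring.
(* This antiderivative differs from p / (1 + p) by the constant 1. *)
have dH t : 0 < t -> is_derive t 1 (fun t => - (1 + p t)^-1) (h t).
  move=> t0; have dpt := dp _ t0.
  have d1 : is_derive t 1 (fun t => 1 + p t) (s * p t / t).
    by apply: is_derive_eq; rewrite add0r mul1r.
  have d2 := is_deriveV (f := fun t => 1 + p t) (x := t) (lt0r_neq0 (p1 t)) d1.
  apply: is_derive_eq.
  rewrite /h /GRing.scale/=; field.
  by rewrite !gt_eqF.
have ch t : 0 < t -> {for t, continuous h}.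
  move=> t0.
  have cp : {for t, continuous p}.
    apply: differentiable_continuous; apply/derivable1_diffP.
    by have [] := dp _ t0.
  have c1p : {for t, continuous (fun t => (1 + p t) ^+ 2)}.
    have c1 : {for t, continuous (fun t => 1 + p t)}.
      by apply: continuousD => //; exact: cst_continuous.
    exact: (continuousM c1 c1).
  apply: continuousM.
    apply: continuousM; first by apply: continuousM => //; exact: cst_continuous.
    by apply: inv_continuous; rewrite gt_eqF.
  by apply: continuousV => //; rewrite gt_eqF// exprn_gt0.
have ih : mu.-integrable U (EFin \o h).
  apply: (integrable_bounded_antiderivative (F := fun t => - (1 + p t)^-1)
    (M := 1)) => // t t0.
  - by rewrite /h ltW// divr_gt0 ?exprn_gt0// divr_gt0// mulr_gt0.
  - rewrite normrN ger0_norm ?invr_ge0 ?(ltW (p1 t))//.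
    by rewrite invf_le1// lerDl ltW.
(* From p <= C e^(t/2) and 1 <= e^(t/2) follows (1 + p)^2 <= (1 + C)^2 e^t, so e^(-t) p / t is at
   most (1 + C)^2 (p / t) / (1 + p)^2; the division by s cancels the factor s of [h]. *)
pose K := (1 + C) ^+ 2 / s.
apply: le_integrable (integrableZl _ K ih) => //.
  apply/measurable_EFinP; apply: continuous_half_line_measurable.
  exact: continuous_kern.
move=> t; rewrite /= in_itv/= andbT => t0.
rewrite -[leLHS]/(`|kern s tau phi t|%:E) -[leRHS]/(`|K * h t|%:E) lee_fin.
rewrite (le_trans (normr_kern _ _ _ _))// (le_trans _ (ler_norm _))//.
have -> : expR ((s - 1) * ln t - t) = p t * expR (- t) / t.
  by rewrite /p -expRD (expR_ln_shift s)// [t * _]mulrC mulfK// gt_eqF.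
have -> : K * h t = p t * ((1 + C) ^+ 2 / (1 + p t) ^+ 2) / t.
  by rewrite /K /h; field; rewrite !gt_eqF.
rewrite ler_pM2r ?invr_gt0// ler_pM2l// ler_pdivlMr ?exprn_gt0//.
have E1 : 1 <= expR (t / 2) by rewrite -expR0 ler_expR divr_ge0// ltW.
have EE : expR (- t) * expR (t / 2) ^+ 2 = 1.
  by rewrite expr2 -!expRD -[RHS]expR0; congr expR; field.
have pC : 1 + p t <= (1 + C) * expR (t / 2).
  by rewrite mulrDl mul1r lerD//; exact: CP.
have pC2 : (1 + p t) ^+ 2 <= ((1 + C) * expR (t / 2)) ^+ 2.
  have h1 := ltW (p1 t).
  have h2 : 0 <= (1 + C) * expR (t / 2) by rewrite mulr_ge0 ?addr_ge0 ?expR_ge0.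
  by rewrite lerXn2r ?nnegrE.
apply: (le_trans (ler_wpM2l (expR_ge0 (- t)) pC2)).
by rewrite exprMn mulrCA EE mulr1.
Qed.

End Kernel.

(** * Recurrence and positivity of the real integrals *)

Section GammaReal.
Context {R : realType}.
Local Notation mu := (@lebesgue_measure R).
Local Notation U := (`]0%R, +oo[%classic : set R).
Implicit Types (s tau phi t a : R).

Lemma kern_cvg0 s tau phi : 0 < s -> kern (s + 1) tau phi t @[t --> 0^'+] --> 0.
Proof.
move=> s0; apply: norm_cvg0.
apply: (@squeeze_cvgr _ _ _ _ (fun=> 0) (fun t => t `^ s)); last 2 first.
- exact: cvg_cst.
- exact: powR_cvg0.
near=> t; rewrite normr_ge0/= (le_trans (normr_kern _ _ _ _))//.
have t0 : 0 < t by near: t; exact: nbhs_right_gt.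
by rewrite addrK /powR gt_eqF// ler_expR gerBl ltW.
Unshelve. all: by end_near. Qed.

(** The power t^s costs only e^(t/2), which leaves a decay of e^(-t/2). *)
Lemma kern_cvgy s tau phi : 0 < s -> kern (s + 1) tau phi t @[t --> +oo] --> 0.
Proof.
move=> s0; have [C C0 CP] := expR_ln_bound s0.
apply: norm_cvg0.
apply: (@squeeze_cvgr _ _ _ _ (fun=> 0) (fun t => C * expR (- (t / 2)))).
- near=> t; rewrite normr_ge0/= (le_trans (normr_kern _ _ _ _))//.
  have t0 : 0 < t by near: t; exact: nbhs_pinfty_gt.
  rewrite addrK expRD (le_trans (ler_wpM2r (expR_ge0 _) (CP _ t0)))//.
  by rewrite -mulrA -expRD [_ - t](_ : _ = - (t / 2))//; field.
- exact: cvg_cst.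
- rewrite -[X in _ --> X](mulr0 C); apply: cvgM; first exact: cvg_cst.
  apply: (cvg_comp _ (fun x => expR (- x)) _ (@cvgr_expR R)).
  by apply: gt0_cvgMly; [rewrite invr_gt0|exact: cvg_id].
Unshelve. all: by end_near. Qed.

Definition kernI s tau phi : R := \int[mu]_(t in U) kern s tau phi t.

(** Integrates [is_derive_kernS], the boundary terms being zero. It is the real form of
    multiplication by s + i tau, a phase shift of pi/2 standing for the factor i. *)
Lemma kernI_rec s tau phi : 0 < s ->
  kernI (s + 1) tau phi =
  s * kernI s tau phi + tau * kernI s tau (phi + pi / 2).
Proof.
move=> s0; have s10 : 0 < s + 1 by rewrite addr_gt0.
have i1 := integrable_kern tau phi s0.
have i2 := integrable_kern tau phi s10.
have i3 := integrable_kern tau (phi + pi / 2) s0.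
have i4 := integrable_half_lineZl s i1.
have i5 := integrable_half_lineZl tau i3.
have i6 := integrable_half_lineB i4 i2.
have := @Rintegral_half_line R (kern (s + 1) tau phi) _ 0 0 _
  (@is_derive_kernS R s tau phi) (integrable_half_lineD i6 i5)
  (kern_cvg0 _ _ s0) (kern_cvgy _ _ s0).
rewrite subrr RintegralD// RintegralB// !RintegralZl// -!/(kernI _ _ _).
move=> H; apply/eqP; rewrite -subr_eq0 -oppr_eq0; apply/eqP.
rewrite -[RHS]H; first by ring.
move=> t t0.
have c1 := @continuous_kern R s tau phi _ t0.
have c2 := @continuous_kern R (s + 1) tau phi _ t0.
have c3 := @continuous_kern R s tau (phi + pi / 2) _ t0.
apply: continuousD; last by apply: continuousM => //; exact: cst_continuous.
by apply: continuousB => //; apply: continuousM => //; exact: cst_continuous.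
Qed.

Lemma kern00 s t : kern s 0 0 t = expR ((s - 1) * ln t - t).
Proof. by rewrite /kern mul0r addr0 cos0 mulr1. Qed.

Lemma kernI_0rec s : 0 < s -> kernI (s + 1) 0 0 = s * kernI s 0 0.
Proof. by move=> s0; rewrite kernI_rec// mul0r addr0. Qed.

Lemma kernI1 : kernI 1 0 0 = 1.
Proof.
have E t : kern 1 0 0 t = expR (- t) by rewrite kern00 subrr mul0r sub0r.
have d t : is_derive t 1 (fun t => - expR (- t)) (kern 1 0 0 t).
  rewrite E; have d1 : is_derive t 1 (fun t => - t) (- 1) by exact: is_deriveN.
  have d2 := is_derive1_comp (is_derive_expR _) d1.
  by apply: is_derive_eq; ring.
rewrite /kernI (@Rintegral_half_line R (fun t => - expR (- t)) _ (- 1) 0).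
- by rewrite opprK add0r.
- by move=> t t0; exact: continuous_kern.
- exact: integrable_kern.
- apply: cvgN; rewrite -[X in _ --> X]expR0 -[X in expR X]oppr0.
  apply/cvg_at_right_filter/(continuous_comp (f := fun t => - t)).
    exact: opp_continuous.
  exact: continuous_expR.
- by rewrite -[X in _ --> X]oppr0; apply: cvgN; exact: cvgr_expR.
Qed.

(* [t^(a-1) = t exp ((a-2) ln t) >= t + (a-2) (t-1)] since [ln t >= 1 - 1/t]. *)
Lemma kernI_ge1 a : 2 <= a -> 1 <= kernI a 0 0.
Proof.
move=> a2; have a0 : 0 < a by rewrite (lt_le_trans _ a2).
have I1 : kernI 2 0 0 = 1.
  by rewrite -[X in kernI X](_ : 1 + 1 = _)// kernI_0rec// kernI1 mulr1.
(* The right side is the integral of the minorant ((a-1) t - (a-2)) e^(-t). *)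
have -> : 1 = (a - 1) * kernI 2 0 0 - (a - 2) * kernI 1 0 0.
  by rewrite I1 kernI1; ring.
have i1 := integrable_kern 0 0 (ltr01 : 0 < 1 :> R).
have i2 := integrable_kern 0 0 (ltr0Sn R 1).
have i3 := integrable_half_lineZl (a - 1) i2.
have i4 := integrable_half_lineZl (a - 2) i1.
rewrite /kernI -!RintegralZl// -RintegralB//.
apply: le_Rintegral => //.
- exact: (integrable_half_lineB i3 i4).
- exact: integrable_kern.
move=> t /half_line_gt0 t0.
rewrite [X in _ * X - _](_ : _ = t * kern 1 0 0 t); last by rewrite -kernS.
have -> : kern a 0 0 t = t * (expR ((a - 2) * ln t) * kern 1 0 0 t).
  rewrite !kern00 -expRD -[X in _ = X * _]lnK ?posrE// -expRD; congr expR; ring.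
have : 0 < kern 1 0 0 t by rewrite kern00 expR_gt0.
move: (kern 1 0 0 t) => w w0.
rewrite !mulrA -mulrBl ler_pM2r//.
have h1 := expR_ge1Dx ((a - 2) * ln t).
have h2 := expR_ge1Dx (- ln t); rewrite expRN lnK ?posrE// in h2.
have h3 : t - 1 <= t * ln t.
  have := ler_wpM2l (ltW t0) h2.
  by rewrite divff ?gt_eqF// mulrDr mulr1 mulrN; lra.
apply: (@le_trans _ _ (t * (1 + (a - 2) * ln t))); last by rewrite ler_pM2l.
have : (a - 2) * (t - 1) <= (a - 2) * (t * ln t) by rewrite ler_wpM2l// subr_ge0.
nra.
Qed.

(** The phase makes the cosine equal to 1 at t = a, where the mass concentrates. *)
Lemma kernI_gt0 a tau : 2 <= a -> 2 * tau ^+ 2 < a - 1 ->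
  0 < kernI a tau (- (tau * ln a)).
Proof.
move=> a2 ta; have a0 : 0 < a by rewrite (lt_le_trans _ a2).
have a10 : 0 < a - 1 by lra.
have a11 : 0 < a + 1 by lra.
have Ga := kernI_ge1 a2.
have E1 := kernI_0rec a0.
have E2 := kernI_0rec a10; rewrite subrK in E2.
have i1 := integrable_kern 0 0 a0.
have i2 := integrable_kern 0 0 a10.
have i3 := integrable_kern 0 0 a11.
have j1 := integrable_half_lineZl (1 + 4 * tau ^+ 2) i1.
have j2 := integrable_half_lineZl (2 * tau ^+ 2 * a) i2.
have j3 := integrable_half_lineZl (2 * tau ^+ 2 / a) i3.
have j12 := integrable_half_lineB j1 j2.
(* With u = t/a the cosine is at least 1 - 2 tau^2 (u - 2 + 1/u); the terms in u and 1/u integrate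
   to Gamma(a+1)/a and a Gamma(a-1). The recurrence reduces the total to Gamma(a) (1 - 2 tau^2 /
   (a-1)). *)
apply: (@lt_le_trans _ _ ((1 + 4 * tau ^+ 2) * kernI a 0 0
   - 2 * tau ^+ 2 * a * kernI (a - 1) 0 0
   - 2 * tau ^+ 2 / a * kernI (a + 1) 0 0)).
  have -> : kernI (a - 1) 0 0 = kernI a 0 0 / (a - 1).
    by rewrite E2 mulrC mulKf// gt_eqF.
  rewrite E1.
  have -> : (1 + 4 * tau ^+ 2) * kernI a 0 0
     - 2 * tau ^+ 2 * a * (kernI a 0 0 / (a - 1))
     - 2 * tau ^+ 2 / a * (a * kernI a 0 0)
     = kernI a 0 0 * ((a - 1 - 2 * tau ^+ 2) / (a - 1)).
    by field; rewrite !gt_eqF.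
  by apply: mulr_gt0; [exact: lt_le_trans ltr01 Ga|rewrite divr_gt0// subr_gt0].
rewrite /kernI -!RintegralZl// -!RintegralB//.
apply: le_Rintegral => //.
- exact: (integrable_half_lineB j12 j3).
- exact: integrable_kern.
move=> t /half_line_gt0 t0.
have -> : kern (a + 1) 0 0 t = t * kern a 0 0 t by exact: kernS.
have -> : kern (a - 1) 0 0 t = kern a 0 0 t / t.
  by rewrite -{2}[a](subrK 1) kernS// mulrC mulKf// gt_eqF.
rewrite [leRHS](_ : _ = kern a 0 0 t * cos (tau * (ln t - ln a))); last first.
  by rewrite kern00 /kern mulrBr.
have w0 : 0 < kern a 0 0 t by rewrite kern00 expR_gt0.
rewrite [leLHS](_ : _ = kern a 0 0 t *
    (1 - tau ^+ 2 * (4 * (t / a - 2 + a / t)) / 2)); last first.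
  by field; rewrite !gt_eqF.
rewrite ler_pM2l//; apply: le_trans (cos_ge1B _).
have := sqr_le_cosh (ln t - ln a).
rewrite opprB !expRD !expRN !lnK ?posrE// => h.
by rewrite lerD2l lerN2 ler_pM2r ?invr_gt0// exprMn ler_wpM2l// sqr_ge0.
Qed.

End GammaReal.

(** * The complex Gamma function and the Mellin transform *)

Section GammaComplex.
Context {K : realType}.
Local Notation C := K[i].
Local Notation mu := (@lebesgue_measure K).
Local Notation U := (`]0%R, +oo[%classic : set K).

Definition Cintegrable (h : K -> C) : Prop :=
  mu.-integrable U (EFin \o (fun t => complex.Re (h t))) /\
  mu.-integrable U (EFin \o (fun t => complex.Im (h t))).

Lemma CintegrableD h k : Cintegrable h -> Cintegrable k ->
  Cintegrable (fun t => h t + k t).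
Proof.
move=> [h1 h2] [k1 k2]; split.
  apply: eq_integrable (integrable_half_lineD h1 k1) => // t _ /=.
  by case: (h t) => ? ?; case: (k t).
apply: eq_integrable (integrable_half_lineD h2 k2) => // t _ /=.
by case: (h t) => ? ?; case: (k t).
Qed.

Lemma CintegralD h k : Cintegrable h -> Cintegrable k ->
  Cintegral U (fun t => h t + k t) = Cintegral U h + Cintegral U k.
Proof.
move=> [h1 h2] [k1 k2]; rewrite /Cintegral/=.
apply/eqP; rewrite eq_complex/=; apply/andP; split; apply/eqP.
  rewrite -RintegralD//; apply: eq_Rintegral => t _.
  by case: (h t) => ? ?; case: (k t).
rewrite -RintegralD//; apply: eq_Rintegral => t _.
by case: (h t) => ? ?; case: (k t).
Qed.

Lemma CintegrableZ (c : C) h : Cintegrable h -> Cintegrable (fun t => c * h t).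
Proof.
case: c => a b [h1 h2]; split.
  apply: eq_integrable (integrable_half_lineB (integrable_half_lineZl a h1)
    (integrable_half_lineZl b h2)) => // t _ /=.
  by case: (h t).
apply: eq_integrable (integrable_half_lineD (integrable_half_lineZl a h2)
  (integrable_half_lineZl b h1)) => // t _ /=.
by case: (h t).
Qed.

Lemma CintegralZ (c : C) h : Cintegrable h ->
  Cintegral U (fun t => c * h t) = c * Cintegral U h.
Proof.
case: c => a b [h1 h2]; rewrite /Cintegral/=.
have a1 := integrable_half_lineZl a h1.
have a2 := integrable_half_lineZl a h2.
have b1 := integrable_half_lineZl b h1.
have b2 := integrable_half_lineZl b h2.
apply/eqP; rewrite eq_complex/=; apply/andP; split; apply/eqP.
  rewrite -!RintegralZl// -RintegralB//; apply: eq_Rintegral => t _.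
  by case: (h t).
rewrite -!RintegralZl// -RintegralD//; apply: eq_Rintegral => t _.
by case: (h t).
Qed.

Lemma eq_Cintegral h k : (forall t, 0 < t -> h t = k t) ->
  Cintegral U h = Cintegral U k.
Proof.
move=> hk; rewrite /Cintegral; congr (_ +i* _); apply: eq_Rintegral => t;
  by rewrite inE => /half_line_gt0/hk ->.
Qed.

Lemma Cintegral_sum n (h : 'I_n -> K -> C) : (forall i, Cintegrable (h i)) ->
  Cintegral U (fun t => \sum_(i < n) h i t) = \sum_(i < n) Cintegral U (h i).
Proof.
have int0 : Cintegrable (fun=> 0) by split; exact: integrable0.
move=> hi.
suff : forall r : seq 'I_n, Cintegrable (fun t => \sum_(i <- r) h i t) /\
    Cintegral U (fun t => \sum_(i <- r) h i t) = \sum_(i <- r) Cintegral U (h i).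
  by move=> /(_ (index_enum _))[].
elim=> [|i r [IH1 IH2]].
  split.
    rewrite [X in Cintegrable X](_ : _ = fun=> 0)//.
    by apply/funext => t; rewrite big_nil.
  (* The empty sum is written as 0 times the zero function so that [CintegralZ] evaluates its
     integral. *)
  rewrite big_nil (eq_Cintegral (k := fun t => 0 * (fun=> 0) t)).
    by rewrite CintegralZ// mul0r.
  by move=> t _; rewrite big_nil mul0r.
rewrite big_cons; have -> : (fun t => \sum_(j <- i :: r) h j t) =
    (fun t => h i t + \sum_(j <- r) h j t).
  by apply/funext => t; rewrite big_cons.
by split; [exact: CintegrableD|rewrite CintegralD// IH2].
Qed.

Definition gamma_kern (s : C) (t : K) : C := Cpow t (s - 1) * (expR (- t))%:C.

(** The imaginary part has phase - pi/2 because sin y = cos (y - pi/2). *)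
Lemma gamma_kernE (s : C) t : gamma_kern s t =
  kern (complex.Re s) (complex.Im s) 0 t
  +i* kern (complex.Re s) (complex.Im s) (- (pi / 2)) t.
Proof.
case: s => a b; rewrite /gamma_kern /Cpow /Cexp /kern/=.
apply/eqP; rewrite eq_complex/=; apply/andP; split; apply/eqP;
  rewrite ?cosBpihalf !(mulr0, addr0, subr0, mul0r, add0r, oppr0) !expRD; ring.
Qed.

Lemma Cintegrable_gamma_kern (s : C) : 0 < complex.Re s ->
  Cintegrable (gamma_kern s).
Proof.
move=> s0; split; apply: eq_integrable (integrable_kern _ _ s0) => // t _;
  by rewrite /comp gamma_kernE.
Qed.

Lemma GammaE (s : C) : Gamma s =
  kernI (complex.Re s) (complex.Im s) 0
  +i* kernI (complex.Re s) (complex.Im s) (- (pi / 2)).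
Proof.
rewrite /Gamma /Cintegral /kernI; congr (_ +i* _); apply: eq_Rintegral => t _;
  by rewrite -/(gamma_kern s t) gamma_kernE.
Qed.

(** By the addition formula, an integral of any phase is a real combination of the real and
    imaginary parts of Gamma(s + i tau), and so vanishes with it. *)
Lemma kernI_phase (s tau phi : K) : 0 < s ->
  kernI s tau phi =
  cos phi * kernI s tau 0 - sin phi * kernI s tau (- (pi / 2)).
Proof.
move=> s0.
have i1 := integrable_kern tau 0 s0.
have i2 := integrable_kern tau (- (pi / 2)) s0.
have i3 := integrable_half_lineZl (cos phi) i1.
have i4 := integrable_half_lineZl (sin phi) i2.
rewrite /kernI -!RintegralZl// -RintegralB//.
apply: eq_Rintegral => t _; rewrite /kern cosBpihalf addr0 cosD; ring.
Qed.

Lemma GammaS (s : C) : 0 < complex.Re s -> Gamma (s + 1) = s * Gamma s.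
Proof.
case: s => a b /= a0; rewrite !GammaE/= addr0 !kernI_rec//.
rewrite addNr add0r (kernI_phase b (pi / 2) a0).
rewrite cos_pihalf sin_pihalf.
apply/eqP; rewrite eq_complex/=; apply/andP; split; apply/eqP; ring.
Qed.

Lemma Re_addn (s : C) n : complex.Re (s + n%:R) = complex.Re s + n%:R.
Proof. by rewrite -[n%:R in LHS](rmorph_nat (@real_complex K)); case: s. Qed.

Lemma Im_addn (s : C) n : complex.Im (s + n%:R) = complex.Im s.
Proof.
rewrite -[n%:R in LHS](rmorph_nat (@real_complex K)).
by case: s => a b /=; rewrite addr0.
Qed.

(** Iterating [GammaS] gives the product s (s+1) ... (s+n-1), and each factor s + k is the opposite
    of - s - k. *)
Lemma Gamma_addn (s : C) n : 0 < complex.Re s ->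
  Gamma (s + n%:R) = (-1) ^+ n * (falling n).[- s] * Gamma s.
Proof.
move=> s0; elim: n => [|n IH].
  by rewrite addr0 /falling big_ord0 hornerC !mul1r.
rewrite -natr1 addrA GammaS; last first.
  by rewrite Re_addn (lt_le_trans s0)// lerDl.
rewrite IH fallingS hornerM hornerXsubC exprS; ring.
Qed.

(** A zero at s propagates to every s + n without changing the imaginary part, and for large n it
    contradicts [kernI_gt0] through [kernI_phase]. *)
Lemma Gamma_neq0 (s : C) : 0 < complex.Re s -> Gamma s != 0.
Proof.
move=> s0; apply/negP => /eqP G0.
set tau := complex.Im s.
(* The offset 3 gives n > 2 tau^2 + 2, enough for both hypotheses of [kernI_gt0]. *)
pose n := (Num.trunc (2 * tau ^+ 2)).+3.
have /= Gn : Gamma (s + n%:R) = 0 by rewrite Gamma_addn// G0 mulr0.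
set a := complex.Re (s + n%:R).
have aE : a = complex.Re s + n%:R by exact: Re_addn.
have n2 : 2 * tau ^+ 2 + 2 < n%:R.
  rewrite /n -[_.+3]addn2 natrD ltrD2r; exact: truncnS_gt.
have t0 : 0 <= tau ^+ 2 by exact: sqr_ge0.
have a2 : 2 <= a by rewrite aE; lra.
have ta : 2 * tau ^+ 2 < a - 1 by rewrite aE; lra.
have := kernI_gt0 a2 ta.
rewrite kernI_phase; last by rewrite (lt_le_trans _ a2).
move: Gn; rewrite GammaE Im_addn => -[-> ->].
by rewrite !mulr0 subrr ltxx.
Qed.

Lemma gamma_kernS (s : C) t : 0 < t ->
  gamma_kern (s + 1) t = t%:C * gamma_kern s t.
Proof.
by move=> t0; rewrite !gamma_kernE; case: s => a b /=; rewrite addr0 !kernS//;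
  apply/eqP; rewrite eq_complex/= !mul0r subr0 addr0 !eqxx.
Qed.

Lemma gamma_kern_addn (s : C) n t : 0 < t ->
  gamma_kern (s + n%:R) t = t%:C ^+ n * gamma_kern s t.
Proof.
move=> t0; elim: n => [|n IH]; first by rewrite addr0 mul1r.
by rewrite -natr1 addrA gamma_kernS// IH exprS mulrA.
Qed.

(** A factor t^i moves the Gamma integrand from - x to - x + i. The sign (-1)^i coming from f(-t)
    cancels the one in [Gamma_addn], and Gamma(- x) is divided out. *)
Lemma mellin_value_falling_map (f : {poly C}) (x : C) : complex.Re x < 0 ->
  (falling_map f).[x] = mellin_value f x.
Proof.
move=> x0; have s0 : 0 < complex.Re (- x) by move: x0; case: x => a b /=; lra.
have sn n : 0 < complex.Re (- x + n%:R).
  by rewrite Re_addn (lt_le_trans s0)// lerDl.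
rewrite /mellin_value (eq_Cintegral (k := fun t =>
  \sum_(i < size f) (f`_i * (-1) ^+ i) * gamma_kern (- x + i%:R) t)); last first.
  move=> t t0; rewrite -mulrA -/(gamma_kern _ t) horner_coef mulr_suml.
  by apply: eq_bigr => i _; rewrite gamma_kern_addn// [(- _%:C) ^+ _]exprNn !mulrA.
rewrite Cintegral_sum; last first.
  by move=> i; apply: CintegrableZ; apply: Cintegrable_gamma_kern; exact: sn.
rewrite mulr_sumr /falling_map horner_sum; apply: eq_bigr => i _.
rewrite CintegralZ; last by apply: Cintegrable_gamma_kern; exact: sn.
rewrite -[Cintegral _ _]/(Gamma _) Gamma_addn// opprK hornerZ.
have sgn : (-1) ^+ i * (-1) ^+ i = 1 :> C.
  by rewrite -exprMn mulrNN mulr1 expr1n.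
rewrite [RHS](_ : _ = ((-1) ^+ i * (-1) ^+ i) * (f`_i * (falling i).[x]) *
    ((Gamma (- x))^-1 * Gamma (- x))); last by ring.
by rewrite sgn mulVf ?Gamma_neq0// mul1r mulr1.
Qed.

Lemma eq_poly_left_half_plane (f g : {poly C}) :
  (forall x, complex.Re x < 0 -> f.[x] = g.[x]) -> f = g.
Proof.
move=> fg; apply/eqP; rewrite -subr_eq0; apply/eqP.
(* The negative integers from -1 down give as many distinct roots of f - g as its size, one more
   than its degree allows. *)
apply: (@roots_geq_poly_eq0 _ _ [seq - n.+1%:R | n <- iota 0 (size (f - g))]).
- apply/allP => _ /mapP[n _ ->]; rewrite /root !hornerE fg ?subrr//.
  rewrite -(rmorph_nat (@real_complex K)) -rmorphN/=.
  by rewrite oppr_lt0.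
- rewrite map_inj_uniq ?iota_uniq// => m n /oppr_inj /eqP.
  by rewrite eqr_nat => /eqP[].
- by rewrite size_map size_iota.
Qed.

(** Existence and uniqueness of the interpolating polynomial exclude the default value of [xget]. *)
Lemma MellinE (f : {poly C}) : Mellin f = falling_map f.
Proof.
rewrite /Mellin; apply: xget_unique => [x|g] /=; last move=> gP.
  exact: mellin_value_falling_map.
apply: eq_poly_left_half_plane => x x0.
by rewrite gP// mellin_value_falling_map.
Qed.

End GammaComplex.

Theorem proposition6p2 (K : realType) (r : {poly K[i]}) :
  Mellin @` range (Pc r) `<=` range (Pd r) /\
  forall n : nat, Mellin (Pc r n) = Pd r n.
Proof.
have MP n : Mellin (Pc r n) = Pd r n by rewrite MellinE falling_map_Pc.
by split => // _ [_ [n _ <-] <-]; exists n.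
Qed.
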